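(* Let $\mathsf R$ be an operad, with associated simplicial groupoid $D_\bullet$, comultiplication $\Delta:\mathbf{Grpd}_{/D_1}\to\mathbf{Grpd}_{/D_1\times D_1}$ and connected Green function $G:C_1\to D_1$. There is an equivalence in $\mathbf{Grpd}_{/D_1\times D_1}$: $$\Delta(G)\simeq\int^{w\in D_0} G^w\times G_w .$$
   Context: **Conventions.** $\mathbf{Grpd}$ is the 2-category of groupoids, $\mathbf{Grpd}/I$ the strict slice, $\mathbf{Grpd}_{/I}$ the weak slice (triangles commuting up to specified isomorphism). A polynomial of groupoids $I\xleftarrow{s}E\xrightarrow{p}B\xrightarrow{t}J$, with $p$ a fibration, defines the polynomial functor $t_!\circ p_*\circ s^*:\mathbf{Grpd}/I\to\mathbf{Grpd}/J$ ($s^*$ is pullback, $t_!$ postcomposition, $p_*$ right adjoint to $p^*$). For a groupoid-indexed family $(E_b)_{b\in B}$, the homotopy sum is $\int^{b\in B}E_b:=\sum_{b\in\pi_0B}E_b/\mathrm{Aut}(b)$, with $/$ the homotopy quotient (action groupoid). $\mathbb B$ is the groupoid of finite sets and bijections, $\mathbb B'$ the groupoid of finite pointed sets and basepoint-preserving bijections, $\underline n$ the fibre of $\mathbb B'\to\mathbb B$ over $n$. $\mathsf S:\mathbf{Grpd}\to\mathbf{Grpd}$ is the symmetric monoidal category monad, represented by $1\leftarrow\mathbb B'\to\mathbb B\to1$, so $\mathsf S(X)=\int^{n\in\mathbb B}\mathrm{Map}(\underline n,X)$; its unit $\eta^{\mathsf S}$ is the inclusion of singleton families and its multiplication $\mu^{\mathsf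 S}$ is concatenation of families. **Operads.** An operad means a coloured symmetric operad in sets; it is identified with a polynomial monad $\mathsf R$ on $\mathbf{Grpd}/I$ represented by $I\leftarrow E\to B\to I$, together with a cartesian monad map to $\mathsf S$ over $F:I\to1$ (maps $E\to\mathbb B'$, $B\to\mathbb B$ forming a pullback square with $E\to B$ and $\mathbb B'\to\mathbb B$, compatibly with the monad structures), where $I$ is a set and $B\to\mathbb B$ is a discrete fibration. Here $I$ is the set of colours, $B$ the disjoint union over $n$ of the action groupoids of the symmetric groups $\mathfrak S_n$ on the sets of $n$-ary operations, $E$ the groupoid of operations with a marked input slot, $E\to I$ gives the colour of the marked slot, $B\to I$ gives the output colour; the monad structure is operad substitution. $F_!:\mathbf{Grpd}/I\to\mathbf{Grpd}$ is the forgetful functor, and $\phi:F_!\mathsf R\Rightarrow\mathsf SF_!$ is the induced cartesian natural transformation, making $(F_!,\phi)$ a monad opfunctor. **Bar construction.** $A$ is the terminal object of $\mathbf{Grpd}/I$ and $\alpha:\mathsf RA\to A$ the unique map (terminal $\mathsf R$-algebra). Put $C_n:=F_!\mathsf R^nA$ and $D_n:=\mathsf S C_n$; thus $C_0=I$, $C_1=B$. The maps $d_k:C_{n+1}\to C_n$ ($0\le k\le n$) are $F_!\mathsf R^{n-k}\mu_{\mathsf R^{k-1}A}$ with the convention $\mu_{\mathsf R^{-1}A}=\alpha$, and $s_k:C_n\to C_{n+1}$ are $F_!\mathsf R^{n-k}\eta_{\mathsf R^kA}$. Applying $\mathsf S$ to these and adding the top face maps $d_{n+1}:=\mu^{\mathsf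 S}_{C_n}\circ\mathsf S(\phi_{\mathsf R^nA}):D_{n+1}\to D_n$ gives a simplicial groupoid $D_\bullet$. **Comultiplication and Green function.** $\Delta:=(d_2,d_0)_!\circ d_1^*:\mathbf{Grpd}_{/D_1}\to\mathbf{Grpd}_{/D_1\times D_1}$ is given by (homotopy) pullback and postcomposition along $D_1\xleftarrow{d_1}D_2\xrightarrow{(d_2,d_0)}D_1\times D_1$. The connected Green function is the object $G:=\eta^{\mathsf S}_{C_1}:C_1\to D_1$ of $\mathbf{Grpd}_{/D_1}$. For $w\in D_0$: $G_w$ is the object ${}_w(C_1)\to C_1\to D_1$ of $\mathbf{Grpd}_{/D_1}$, where ${}_w(C_1)$ is the homotopy fibre over $w$ of $C_1\xrightarrow{G}D_1\xrightarrow{d_1}D_0$; $G^w$ is the object $(D_1)_w\to D_1$, where $(D_1)_w$ is the homotopy fibre over $w$ of $d_0:D_1\to D_0$. The homotopy sum over $w$ is regarded as an object over $D_1\times D_1$ via the maps $(D_1)_w\times{}_w(C_1)\to D_1\times D_1$. *)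

(* Defs.v *)
(* MathComp.  Morphisms are compared by Leibniz equality, whence the use of
   functional extensionality and proof irrelevance; choice is used to pick
   representatives of isomorphism classes. *)
#[warnings="-notation-overridden"]
From mathcomp Require Import all_boot.
From mathcomp Require Import boolp.

Set Implicit Arguments.
Unset Strict Implicit.
Unset Printing Implicit Defensive.

Declare Scope grpd_scope.
Delimit Scope grpd_scope with grpd.
Local Open Scope grpd_scope.

Lemma existT_inj (T : Type) (P : T -> Type) (x : T) (p q : P x) :
  existT P x p = existT P x q -> p = q.
Proof.
move=> e; have /= := projT2_eq e.
by rewrite (Prop_irrelevance (projT1_eq e) erefl).
Qed.

Record groupoid := Groupoid {
  ob :> Type;
  hom : ob -> ob -> Type;
  idm : forall x, hom x x;
  cmp : forall x y z, hom y z -> hom x y -> hom x z;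
  invm : forall x y, hom x y -> hom y x;
  cmp1m : forall x y (f : hom x y), cmp (idm y) f = f;
  cmpm1 : forall x y (f : hom x y), cmp f (idm x) = f;
  cmpA : forall x y z w (h : hom z w) (g : hom y z) (f : hom x y),
    cmp h (cmp g f) = cmp (cmp h g) f;
  cmpVm : forall x y (f : hom x y), cmp (invm f) f = idm x }.

Arguments hom {g} : rename.
Arguments idm {g} x : rename.
Arguments cmp {g x y z} : rename.
Arguments invm {g x y} : rename.

Notation "g ** f" := (cmp g f) (at level 40, left associativity) : grpd_scope.

Definition idto (X : groupoid) (x y : X) (e : x = y) : hom x y :=
  eq_rect x (hom x) (idm x) y e.

Lemma cmpmV (X : groupoid) (x y : X) (f : hom x y) : f ** invm f = idm y.
Proof.
rewrite -[f ** invm f]cmp1m -{1}(cmpVm (invm f)) -cmpA.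
by rewrite [invm f ** (f ** _)]cmpA cmpVm cmp1m cmpVm.
Qed.

Lemma cmpmI (X : groupoid) (x y z : X) (g : hom y z) (f f' : hom x y) :
  g ** f = g ** f' -> f = f'.
Proof.
by move=> e; rewrite -[f]cmp1m -(cmpVm g) -cmpA e cmpA cmpVm cmp1m.
Qed.

Record functor (X Y : groupoid) := Functor {
  fob :> X -> Y;
  fmap : forall x y, hom x y -> hom (fob x) (fob y);
  fmap1 : forall x, fmap (idm x) = idm (fob x);
  fmapM : forall x y z (g : hom y z) (f : hom x y),
    fmap (g ** f) = fmap g ** fmap f }.

Arguments fmap {X Y} f {x y} : rename.

Definition idF (X : groupoid) : functor X X :=
  @Functor X X id (fun _ _ => id) (fun _ => erefl) (fun _ _ _ _ _ => erefl).

Definition compF (X Y Z : groupoid) (G : functor Y Z) (F : functor X Y) :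
  functor X Z.
Proof.
refine (@Functor X Z (fun x => G (F x)) (fun _ _ f => fmap G (fmap F f)) _ _).
- by move=> x; rewrite !fmap1.
- by move=> x y z g f; rewrite !fmapM.
Defined.

Record nat_iso (X Y : groupoid) (F G : functor X Y) := NatIso {
  component :> forall x, hom (F x) (G x);
  naturality : forall x y (f : hom x y),
    fmap G f ** component x = component y ** fmap F f }.

Definition prodG (X Y : groupoid) : groupoid.
Proof.
refine (@Groupoid (X * Y)%type (fun u v => (hom u.1 v.1 * hom u.2 v.2)%type)
  (fun u => (idm u.1, idm u.2)) (fun _ _ _ g f => (g.1 ** f.1, g.2 ** f.2))
  (fun _ _ f => (invm f.1, invm f.2)) _ _ _ _).
- by move=> u v [f g] /=; rewrite !cmp1m.
- by move=> u v [f g] /=; rewrite !cmpm1.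
- by move=> u v w t [h h'] [g g'] [f f'] /=; rewrite !cmpA.
- by move=> u v [f g] /=; rewrite !cmpVm.
Defined.

Definition pairF (X Y Z : groupoid) (F : functor X Y) (G : functor X Z) :
  functor X (prodG Y Z).
Proof.
refine (@Functor X (prodG Y Z) (fun x => (F x, G x))
  (fun _ _ f => (fmap F f, fmap G f)) _ _).
- by move=> x; rewrite !fmap1.
- by move=> x y z g f; rewrite !fmapM.
Defined.

Definition mapprodF (X Y Z W : groupoid) (F : functor X Z) (G : functor Y W) :
  functor (prodG X Y) (prodG Z W).
Proof.
refine (@Functor (prodG X Y) (prodG Z W) (fun u => (F u.1, G u.2))
  (fun _ _ f => (fmap F f.1, fmap G f.2)) _ _).
- by move=> x; rewrite !fmap1.
- by move=> x y z g f; rewrite !fmapM.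
Defined.

Definition discG (I : Type) : groupoid.
Proof.
refine (@Groupoid I (fun i j => i = j) (fun i => erefl i)
  (fun i j k g f => etrans f g) (fun i j f => esym f) _ _ _ _);
  move=> *; exact: Prop_irrelevance.
Defined.

Section HomotopyPullback.
Variables (X Y Z : groupoid) (F : functor X Z) (G : functor Y Z).

Record hpull_ob := HpullOb {
  hp_l : X; hp_r : Y; hp_iso : hom (F hp_l) (G hp_r) }.

Record hpull_hom (u v : hpull_ob) := HpullHom {
  hph_l : hom (hp_l u) (hp_l v);
  hph_r : hom (hp_r u) (hp_r v);
  hph_sq : fmap G hph_r ** hp_iso u = hp_iso v ** fmap F hph_l }.

Lemma hpull_hom_eq u v (f g : hpull_hom u v) :
  hph_l f = hph_l g -> hph_r f = hph_r g -> f = g.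
Proof.
case: f g => [a b c] [a' b' c'] /= ea eb; move: c c'; rewrite ea eb => c c'.
by congr HpullHom.
Qed.

Definition hpull : groupoid.
Proof.
refine (@Groupoid hpull_ob hpull_hom
  (fun u => @HpullHom u u (idm _) (idm _) _)
  (fun u v w g f =>
     @HpullHom u w (hph_l g ** hph_l f) (hph_r g ** hph_r f) _)
  (fun u v f => @HpullHom v u (invm (hph_l f)) (invm (hph_r f)) _)
  _ _ _ _).
- by move=> *; apply: hpull_hom_eq => /=; rewrite cmp1m.
- by move=> *; apply: hpull_hom_eq => /=; rewrite cmpm1.
- by move=> *; apply: hpull_hom_eq => /=; rewrite cmpA.
- by move=> *; apply: hpull_hom_eq => /=; rewrite cmpVm.
Unshelve.
- by rewrite !fmap1 cmp1m cmpm1.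
- by rewrite !fmapM -cmpA hph_sq cmpA hph_sq cmpA.
- apply: (@cmpmI _ _ _ _ (fmap G (hph_r f))).
  rewrite !cmpA -fmapM cmpmV fmap1 cmp1m hph_sq -cmpA -fmapM cmpmV fmap1.
  by rewrite cmpm1.
Defined.

Definition hpull_snd : functor hpull Y :=
  @Functor hpull Y hp_r (fun _ _ f => hph_r f)
    (fun _ => erefl) (fun _ _ _ _ _ => erefl).

End HomotopyPullback.

Section HomotopyFibre.
Variables (X B : groupoid) (q : functor X B) (b : B).

Record hfib_ob := HfibOb { hf_pt : X; hf_iso : hom (q hf_pt) b }.

Record hfib_hom (u v : hfib_ob) := HfibHom {
  hfh : hom (hf_pt u) (hf_pt v);
  hfh_tri : hf_iso v ** fmap q hfh = hf_iso u }.

Lemma hfib_hom_eq u v (f g : hfib_hom u v) : hfh f = hfh g -> f = g.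
Proof.
case: f g => [a c] [a' c'] /= ea; move: c c'; rewrite ea => c c'.
by congr HfibHom.
Qed.

Definition hfib : groupoid.
Proof.
refine (@Groupoid hfib_ob hfib_hom
  (fun u => @HfibHom u u (idm _) _)
  (fun u v w g f => @HfibHom u w (hfh g ** hfh f) _)
  (fun u v f => @HfibHom v u (invm (hfh f)) _)
  _ _ _ _).
- by move=> *; apply: hfib_hom_eq => /=; rewrite cmp1m.
- by move=> *; apply: hfib_hom_eq => /=; rewrite cmpm1.
- by move=> *; apply: hfib_hom_eq => /=; rewrite cmpA.
- by move=> *; apply: hfib_hom_eq => /=; rewrite cmpVm.
Unshelve.
- by rewrite fmap1 cmpm1.
- by rewrite fmapM cmpA !hfh_tri.
- by rewrite -(hfh_tri f) -cmpA -fmapM cmpmV fmap1 cmpm1.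
Defined.

Definition hfib_incl : functor hfib X :=
  @Functor hfib X hf_pt (fun _ _ f => hfh f)
    (fun _ => erefl) (fun _ _ _ _ _ => erefl).

End HomotopyFibre.

Record slice (K : groupoid) := Slice {
  dom : groupoid;
  leg : functor dom K }.

Arguments dom {K}.
Arguments leg {K}.

Record slice1 (K : groupoid) (X Y : slice K) := Slice1 {
  s1_fun :> functor (dom X) (dom Y);
  s1_tri : nat_iso (leg X) (compF (leg Y) s1_fun) }.

Arguments s1_tri {K X Y}.

Record slice2 (K : groupoid) (X Y : slice K) (f g : slice1 X Y) := Slice2 {
  s2_nat :> nat_iso f g;
  s2_tri : forall x, fmap (leg Y) (s2_nat x) ** s1_tri f x = s1_tri g x }.

Definition id1 (K : groupoid) (X : slice K) : slice1 X X.
Proof.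
refine (@Slice1 K X X (idF _)
  (@NatIso _ _ _ (compF _ (idF _)) (fun x => idm (leg X x)) _)).
by move=> x y f /=; rewrite cmpm1 cmp1m.
Defined.

Definition comp1 (K : groupoid) (X Y Z : slice K)
  (g : slice1 Y Z) (f : slice1 X Y) : slice1 X Z.
Proof.
refine (@Slice1 K X Z (compF g f)
  (@NatIso _ _ (leg X) (compF _ (compF g f))
     (fun x => s1_tri g (f x) ** s1_tri f x) _)).
move=> x y h /=.
rewrite cmpA (naturality (s1_tri g) (fmap f h)) -!cmpA; congr (_ ** _).
exact: (naturality (s1_tri f) h).
Defined.

(** The 2-cells are invertible, being natural transformations of functors
    between groupoids. *)
Definition slice_equiv (K : groupoid) (X Y : slice K) : Prop :=
  exists (f : slice1 X Y) (g : slice1 Y X),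
    inhabited (slice2 (comp1 g f) (id1 X)) /\
    inhabited (slice2 (comp1 f g) (id1 Y)).

Definition slice_prod (K L : groupoid) (X : slice K) (Y : slice L) :
  slice (prodG K L) := Slice (mapprodF (leg X) (leg Y)).

(** A [B]-indexed family in the weak slice over [K] is a pseudofunctor.  The
    comparison cell [fm_comp] is stated for any [d] equal to [c ** b], which
    keeps the coherence laws free of transports. *)
Record family (B K : groupoid) := Family {
  fm_ob :> B -> slice K;
  fm_act : forall x y, hom x y -> slice1 (fm_ob x) (fm_ob y);
  fm_id : forall x, slice2 (fm_act (idm x)) (id1 (fm_ob x));
  fm_comp : forall x y z (b : hom x y) (c : hom y z) (d : hom x z),
    d = c ** b -> slice2 (fm_act d) (comp1 (fm_act c) (fm_act b));
  fm_unitl : forall x y (b : hom x y) (e : b = idm y ** b) (u : dom (fm_ob x)),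
    fm_id y (fm_act b u) ** fm_comp e u = idm (fm_act b u);
  fm_unitr : forall x y (b : hom x y) (e : b = b ** idm x) (u : dom (fm_ob x)),
    fmap (fm_act b) (fm_id x u) ** fm_comp e u = idm (fm_act b u);
  fm_assoc : forall x y z w (b : hom x y) (c : hom y z) (d : hom z w)
    (cb : hom x z) (dc : hom y w) (a : hom x w)
    (e1 : cb = c ** b) (e2 : dc = d ** c) (e3 : a = d ** cb) (e4 : a = dc ** b)
    (u : dom (fm_ob x)),
    fmap (fm_act d) (fm_comp e1 u) ** fm_comp e3 u =
    fm_comp e2 (fm_act b u) ** fm_comp e4 u }.

Arguments fm_act {B K} f {x y} : rename.
Arguments fm_id {B K} f x : rename.
Arguments fm_comp {B K} f {x y z b c d} : rename.

Section HomotopyQuotient.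
Variables (B K : groupoid) (F : family B K) (b : B).

(** The action groupoid of [Aut(b) = hom b b] acting on [F b]. *)
Record hquot_hom (x y : dom (F b)) := HquotHom {
  hq_aut : hom b b;
  hq_hom : hom (fm_act F hq_aut x) y }.

Definition hquot_id (x : dom (F b)) : hquot_hom x x :=
  @HquotHom x x (idm b) (fm_id F b x).

Definition hquot_comp (x y z : dom (F b))
  (g : hquot_hom y z) (f : hquot_hom x y) : hquot_hom x z :=
  @HquotHom x z (hq_aut g ** hq_aut f)
    (hq_hom g ** (fmap (fm_act F (hq_aut g)) (hq_hom f) **
       fm_comp F (erefl (hq_aut g ** hq_aut f)) x)).

Definition hquot_inv (x y : dom (F b)) (f : hquot_hom x y) : hquot_hom y x :=
  @HquotHom y x (invm (hq_aut f))
    (fm_id F b x **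
       (invm (fm_comp F (esym (cmpVm (hq_aut f))) x) **
          fmap (fm_act F (invm (hq_aut f))) (invm (hq_hom f)))).

Lemma hquot_hom_eq (x y : dom (F b)) (g h : hom b b) (e : g = h)
  (m : hom (fm_act F g x) y) (n : hom (fm_act F h x) y) :
  m = n ** idto (congr1 (fun k => fm_act F k x : dom (F b)) e) ->
  HquotHom m = HquotHom n.
Proof. by case: h / e n => n /=; rewrite /idto /= cmpm1 => ->. Qed.

Lemma fm_comp_idto (x y z : B) (p : hom x y) (c : hom y z) (d d' : hom x z)
  (e : d = c ** p) (e' : d' = c ** p) (k : d = d') (u : dom (F x)) :
  fm_comp F e u =
  fm_comp F e' u ** idto (congr1 (fun k => fm_act F k u : dom (F z)) k).
Proof.
by case: d' / k e' => e'; rewrite /idto /= cmpm1 (Prop_irrelevance e e').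
Qed.

Definition hquot : groupoid.
Proof.
refine (@Groupoid (dom (F b)) hquot_hom hquot_id hquot_comp hquot_inv
  _ _ _ _).
- move=> x y [g m]; apply: (hquot_hom_eq (e := cmp1m g)) => /=.
  rewrite (fm_comp_idto _ (esym (cmp1m g)) (cmp1m g)) !cmpA; congr (_ ** _).
  have /= <- := naturality (fm_id F b) m.
  by rewrite -cmpA (fm_unitl (esym (cmp1m g))) cmpm1.
- move=> x y [g m]; apply: (hquot_hom_eq (e := cmpm1 g)) => /=.
  rewrite (fm_comp_idto _ (esym (cmpm1 g)) (cmpm1 g)) !cmpA; congr (_ ** _).
  by rewrite -cmpA (fm_unitr (esym (cmpm1 g))) cmpm1.
- move=> x y z w [h p] [g n] [f m].
  apply: (hquot_hom_eq (e := cmpA h g f)) => /=.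
  rewrite !fmapM -!cmpA; congr (_ ** (_ ** _)).
  rewrite (fm_assoc (erefl (g ** f)) (erefl (h ** g)) erefl (cmpA h g f)).
  rewrite [fm_comp F (erefl (h ** g)) y ** (_ ** _)]cmpA.
  have /= <- := naturality (fm_comp F (erefl (h ** g))) m; rewrite -!cmpA.
  congr (_ ** (_ ** _)).
  exact: fm_comp_idto.
- move=> x y [g m]; apply: (hquot_hom_eq (e := cmpVm g)) => /=.
  rewrite (fm_comp_idto _ (esym (cmpVm g)) (cmpVm g)) !cmpA; congr (_ ** _).
  rewrite -!cmpA; rewrite -[RHS]cmpm1; congr (_ ** _).
  rewrite [fmap _ (invm m) ** _]cmpA -fmapM (cmpVm m) fmap1 cmp1m; exact: cmpVm.
Defined.

Definition hquot_leg : functor hquot K.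
Proof.
refine (@Functor hquot K (leg (F b))
  (fun x y f => fmap (leg (F b)) (hq_hom f) ** s1_tri (fm_act F (hq_aut f)) x)
  _ _).
- by move=> x /=; rewrite (s2_tri (fm_id F b)).
- move=> x y z [g n] [f m] /=.
  rewrite !fmapM -!cmpA (s2_tri (fm_comp F (erefl (g ** f)))) /=.
  congr (_ ** _); rewrite !cmpA; congr (_ ** _).
  exact: (naturality (s1_tri (fm_act F g)) m).
Defined.

End HomotopyQuotient.

Section DisjointUnion.
Variables (T : Type) (X : T -> groupoid).

Definition coprod_hom (u v : {s : T & X s}) : Type :=
  {e : projT1 u = projT1 v &
     hom (eq_rect (projT1 u) (fun s => X s) (projT2 u) (projT1 v) e)
         (projT2 v)}.

Definition coprod_in (s : T) (x y : X s) (f : hom x y) :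
  coprod_hom (existT _ s x) (existT _ s y) :=
  existT (fun e : s = s => hom (eq_rect s (fun s => X s) x s e) y) erefl f.

Definition coprod_id (u : {s : T & X s}) : coprod_hom u u :=
  existT (fun e : projT1 u = projT1 u =>
    hom (eq_rect (projT1 u) (fun s => X s) (projT2 u) (projT1 u) e) (projT2 u))
    erefl (idm (projT2 u)).

Definition coprod_comp (u v w : {s : T & X s}) :
  coprod_hom v w -> coprod_hom u v -> coprod_hom u w.
Proof.
case: u v w => [s x] [t y] [r z] [/= e g] [/= e' f].
case: t / e' y f e g => y f e g; case: r / e z g => z g.
exact: (coprod_in (g ** f)).
Defined.

Definition coprod_inv (u v : {s : T & X s}) : coprod_hom u v -> coprod_hom v u.
Proof.
case: u v => [s x] [t y] [/= e f]; case: t / e y f => y f.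
exact: (coprod_in (invm f)).
Defined.

Definition coprod : groupoid.
Proof.
refine (@Groupoid {s : T & X s} coprod_hom coprod_id coprod_comp coprod_inv
  _ _ _ _).
- case=> [s x] [t y] [/= e f]; case: t / e y f => y f /=.
  by rewrite cmp1m.
- case=> [s x] [t y] [/= e f]; case: t / e y f => y f /=.
  by rewrite cmpm1.
- case=> [s x] [t y] [r z] [q w] [/= e h] [/= e' g] [/= e'' f].
  case: t / e'' y f e' g => y f e' g; case: r / e' z g e h => z g e h.
  by case: q / e w h => w h /=; rewrite cmpA.
- case=> [s x] [t y] [/= e f]; case: t / e y f => y f /=.
  by rewrite cmpVm.
Defined.

Variables (K : groupoid) (F : forall s, functor (X s) K).

Definition copairF_map (u v : coprod) (f : hom u v) :
  hom (F (projT1 u) (projT2 u)) (F (projT1 v) (projT2 v)).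
Proof.
case: u v f => [s x] [t y] [/= e f]; case: t / e y f => y f.
exact: (fmap (F s) f).
Defined.

Definition copairF : functor coprod K.
Proof.
refine (@Functor coprod K (fun u => F (projT1 u) (projT2 u)) copairF_map _ _).
- by case=> [s x] /=; rewrite fmap1.
- case=> [s x] [t y] [r z] [/= e g] [/= e' f].
  case: t / e' y f e g => y f e g; case: r / e z g => z g /=.
  by rewrite fmapM.
Defined.

End DisjointUnion.

(** [pi0 B] is the set of isomorphism classes of [B]; [pi0_rep] chooses a
    representative of each class. *)
Definition pi0 (B : groupoid) : Type :=
  {C : B -> Prop | exists b, C = fun b' => inhabited (hom b b')}.

Definition pi0_rep (B : groupoid) (c : pi0 B) : B :=
  projT1 (cid (proj2_sig c)).

Definition hsum (B K : groupoid) (F : family B K) : slice K :=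
  Slice (copairF (fun c : pi0 B => hquot_leg F (pi0_rep c))).

Section FibreFamily.
Variables (B K : groupoid) (X : slice K) (q : functor (dom X) B).

Definition fibre_ob (b : B) : slice K :=
  Slice (compF (leg X) (hfib_incl q b)).

Definition fibre_act_fun (b c : B) (h : hom b c) :
  functor (hfib q b) (hfib q c).
Proof.
refine (@Functor (hfib q b) (hfib q c)
  (fun u => @HfibOb _ _ q c (hf_pt u) (h ** hf_iso u))
  (fun u v f => @HfibHom _ _ q c
    (@HfibOb _ _ q c (hf_pt u) (h ** hf_iso u))
    (@HfibOb _ _ q c (hf_pt v) (h ** hf_iso v)) (hfh f) _) _ _).
- by move=> u; apply: hfib_hom_eq.
- by move=> *; apply: hfib_hom_eq.
Unshelve.
by rewrite /= -cmpA hfh_tri.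
Defined.

Definition fibre_act (b c : B) (h : hom b c) :
  slice1 (fibre_ob b) (fibre_ob c).
Proof.
refine (@Slice1 K (fibre_ob b) (fibre_ob c) (fibre_act_fun h)
  (@NatIso _ _ (leg (fibre_ob b)) (compF (leg (fibre_ob c)) (fibre_act_fun h))
    (fun u => idm (leg X (hf_pt u))) _)).
by move=> u v f /=; rewrite cmpm1 cmp1m.
Defined.

Definition fibre_id (b : B) : slice2 (fibre_act (idm b)) (id1 (fibre_ob b)).
Proof.
refine (@Slice2 K _ _ (fibre_act (idm b)) (id1 (fibre_ob b))
  (@NatIso _ _ (fibre_act_fun (idm b)) (idF (hfib q b))
    (fun u => @HfibHom _ _ q b (fibre_act_fun (idm b) u) u
                (idm (hf_pt u)) _) _) _).
- by move=> u /=; rewrite fmap1 cmp1m.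
Unshelve.
- by rewrite /= fmap1 cmpm1 cmp1m.
- by move=> u v f; apply: hfib_hom_eq; rewrite /= cmpm1 cmp1m.
Defined.

Definition fibre_comp (x y z : B) (b : hom x y) (c : hom y z) (d : hom x z)
  (e : d = c ** b) :
  slice2 (fibre_act d) (comp1 (fibre_act c) (fibre_act b)).
Proof.
refine (@Slice2 K _ _ (fibre_act d) (comp1 (fibre_act c) (fibre_act b))
  (@NatIso _ _ (fibre_act_fun d) (compF (fibre_act_fun c) (fibre_act_fun b))
    (fun u => @HfibHom _ _ q z (fibre_act_fun d u)
                (fibre_act_fun c (fibre_act_fun b u)) (idm (hf_pt u)) _) _) _).
- by move=> u /=; rewrite fmap1.
Unshelve.
- by rewrite /= fmap1 cmpm1 e cmpA.
- by move=> u v f; apply: hfib_hom_eq; rewrite /= cmpm1 cmp1m.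
Defined.

(** An isomorphism of [B] acts on the homotopy fibres of [q] by composition with
    the comparison isomorphisms. *)
Definition fibre_family : family B K.
Proof.
refine (@Family B K fibre_ob fibre_act fibre_id fibre_comp _ _ _);
  by move=> *; apply: hfib_hom_eq; rewrite /= ?cmp1m.
Defined.

End FibreFamily.

Section FamilyProduct.
Variables (B K L : groupoid) (F : family B K) (G : family B L).

Definition fprod_act (b c : B) (h : hom b c) :
  slice1 (slice_prod (F b) (G b)) (slice_prod (F c) (G c)).
Proof.
refine (@Slice1 _ (slice_prod (F b) (G b)) (slice_prod (F c) (G c))
  (mapprodF (fm_act F h) (fm_act G h))
  (@NatIso _ _ (leg (slice_prod (F b) (G b)))
    (compF (leg (slice_prod (F c) (G c)))
           (mapprodF (fm_act F h) (fm_act G h)))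
    (fun u => (s1_tri (fm_act F h) u.1, s1_tri (fm_act G h) u.2)) _)).
move=> u v [f g] /=; congr pair.
- exact: (naturality (s1_tri (fm_act F h)) f).
- exact: (naturality (s1_tri (fm_act G h)) g).
Defined.

Definition fprod_id (b : B) :
  slice2 (fprod_act (idm b)) (id1 (slice_prod (F b) (G b))).
Proof.
refine (@Slice2 _ _ _ (fprod_act (idm b)) (id1 (slice_prod (F b) (G b)))
  (@NatIso _ _ (fprod_act (idm b)) (id1 (slice_prod (F b) (G b)))
    (fun u => (fm_id F b u.1, fm_id G b u.2)) _) _).
- by move=> u /=; congr pair; exact: (s2_tri (fm_id _ b)).
Unshelve.
move=> u v [f g] /=; congr pair.
- exact: (naturality (fm_id F b) f).
- exact: (naturality (fm_id G b) g).
Defined.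

Definition fprod_comp (x y z : B) (b : hom x y) (c : hom y z) (d : hom x z)
  (e : d = c ** b) :
  slice2 (fprod_act d) (comp1 (fprod_act c) (fprod_act b)).
Proof.
refine (@Slice2 _ _ _ (fprod_act d) (comp1 (fprod_act c) (fprod_act b))
  (@NatIso _ _ (fprod_act d) (comp1 (fprod_act c) (fprod_act b))
    (fun u => (fm_comp F e u.1, fm_comp G e u.2)) _) _).
- by move=> u /=; congr pair; exact: (s2_tri (fm_comp _ e)).
Unshelve.
move=> u v [f g] /=; congr pair.
- exact: (naturality (fm_comp F e) f).
- exact: (naturality (fm_comp G e) g).
Defined.

Definition family_prod : family B (prodG K L).
Proof.
refine (@Family B _ (fun b => slice_prod (F b) (G b))
  fprod_act fprod_id fprod_comp _ _ _).
- by move=> x y b e u /=; congr pair; exact: fm_unitl.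
- by move=> x y b e u /=; congr pair; exact: fm_unitr.
- by move=> x y z w b c d cb dc a e1 e2 e3 e4 u /=; congr pair;
    exact: fm_assoc.
Defined.

End FamilyProduct.

Record bij (A B : Type) := Bij {
  bfun :> A -> B;
  binv : B -> A;
  bfunK : cancel bfun binv;
  binvK : cancel binv bfun }.

Lemma bij_eq (A B : Type) (s t : bij A B) : s =1 t -> s = t.
Proof.
case: s t => [f f' fK f'K] [g g' gK g'K] /= /funext e.
case: g / e gK g'K => gK g'K.
have e : f' = g' by apply: funext => b; rewrite -{1}(g'K b) fK.
by case: g' / e gK g'K => gK g'K; congr Bij.
Qed.

Definition bij_id (A : Type) : bij A A :=
  @Bij A A id id (fun _ => erefl) (fun _ => erefl).

Definition bij_comp (A B C : Type) (t : bij B C) (s : bij A B) : bij A C :=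
  @Bij A C (fun a => t (s a)) (fun c => binv s (binv t c))
    (can_comp (bfunK t) (bfunK s)) (can_comp (binvK s) (binvK t)).

Definition bij_inv (A B : Type) (s : bij A B) : bij B A :=
  Bij (binvK s) (bfunK s).

(** The bijection of disjoint unions induced by [s] and by bijections
    [t a : B a -> B' (s a)]. *)
Definition bij_sum (A A' : Type) (B : A -> Type) (B' : A' -> Type)
  (s : bij A A') (t : forall a, bij (B a) (B' (s a))) :
  bij {a : A & B a} {a' : A' & B' a'}.
Proof.
refine (@Bij {a : A & B a} {a' : A' & B' a'}
  (fun u => existT B' (s (projT1 u)) (t (projT1 u) (projT2 u)))
  (fun v => existT B (binv s (projT1 v))
     (binv (t (binv s (projT1 v)))
        (eq_rect _ B' (projT2 v) _ (esym (binvK s (projT1 v)))))) _ _).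
- case=> a b /=; move: (esym _); rewrite (bfunK s a) => e.
  by rewrite (Prop_irrelevance e erefl) /= bfunK.
- case=> a' b' /=; rewrite (binvK (t (binv s a'))).
  by case: _ / (esym (binvK s a')).
Defined.

Definition bij_sum_unitl (A : Type) : bij A {_ : unit & A}.
Proof.
refine (@Bij A {_ : unit & A} (existT (fun _ => A) tt)
  (fun u => projT2 u) _ _).
- by [].
- by case=> [[] a].
Defined.

Definition bij_sum_unitr (A : Type) : bij A {_ : A & unit}.
Proof.
refine (@Bij A {_ : A & unit} (fun a => existT (fun _ => unit) a tt)
  (fun u => projT1 u) _ _).
- by [].
- by case=> [a []].
Defined.

Definition bij_sumA (A : Type) (B : A -> Type) (C : forall a, B a -> Type) :
  bij {s : {a : A & B a} & C (projT1 s) (projT2 s)}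
      {a : A & {b : B a & C a b}}.
Proof.
refine (@Bij {s : {a : A & B a} & C (projT1 s) (projT2 s)}
  {a : A & {b : B a & C a b}}
  (fun u => existT (fun a => {b : B a & C a b}) (projT1 (projT1 u))
     (existT (C (projT1 (projT1 u))) (projT2 (projT1 u)) (projT2 u)))
  (fun v => existT (fun s : {a : A & B a} => C (projT1 s) (projT2 s))
     (existT B (projT1 v) (projT1 (projT2 v))) (projT2 (projT2 v))) _ _).
- by case=> [[a b] c].
- by case=> [a [b c]].
Defined.

Definition finsum (A : finType) (B : A -> finType) : finType :=
  {a : A & B a} : finType.

(** Coloured symmetric operads in sets, in coordinate-free form: [opn A] is the
    set of all operations, of all profiles, with set of input slots [A]; the
    slot [a] of [f] has colour [inp f a], and [out f] is the output colour.
    Bijections act on the operations by relabelling the input slots, so that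
    [A |-> opn A] is the discrete fibration over finite sets and bijections
    attached to the operad.  The composite [subst f g h] plugs [g a] into the
    slot [a] of [f]; its slots form the disjoint union of the slots of
    the [g a].  Since disjoint unions of finite sets are associative and unital
    only up to canonical bijection, the laws below relabel along it. *)
Record operad := Operad {
  colour : Type;
  opn : finType -> Type;
  inp : forall A, opn A -> A -> colour;
  out : forall A, opn A -> colour;
  relabel : forall A B : finType, bij A B -> opn A -> opn B;
  inp_relabel : forall (A B : finType) (s : bij A B) (f : opn A) (a : A),
    inp (relabel s f) (s a) = inp f a;
  out_relabel : forall (A B : finType) (s : bij A B) (f : opn A),
    out (relabel s f) = out f;
  relabel_id : forall (A : finType) (f : opn A), relabel (bij_id A) f = f;
  relabel_comp : forall (A B C : finType) (t : bij B C) (s : bij A B)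
    (f : opn A), relabel (bij_comp t s) f = relabel t (relabel s f);
  unit_op : colour -> opn unit;
  inp_unit : forall c, inp (unit_op c) tt = c;
  out_unit : forall c, out (unit_op c) = c;
  subst : forall (A : finType) (B : A -> finType) (f : opn A)
    (g : forall a, opn (B a)), (forall a, out (g a) = inp f a) ->
    opn (finsum B);
  inp_subst : forall (A : finType) (B : A -> finType) (f : opn A)
    (g : forall a, opn (B a)) (h : forall a, out (g a) = inp f a)
    (a : A) (b : B a), inp (subst h) (existT (fun a => B a) a b) = inp (g a) b;
  out_subst : forall (A : finType) (B : A -> finType) (f : opn A)
    (g : forall a, opn (B a)) (h : forall a, out (g a) = inp f a),
    out (subst h) = out f;
  subst_relabel : forall (A A' : finType) (B : A -> finType)
    (B' : A' -> finType) (s : bij A A') (t : forall a, bij (B a) (B' (s a)))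
    (f : opn A) (g : forall a, opn (B a)) (h : forall a, out (g a) = inp f a)
    (g' : forall a', opn (B' a'))
    (h' : forall a', out (g' a') = inp (relabel s f) a'),
    (forall a, relabel (t a) (g a) = g' (s a)) ->
    subst h' =
    @relabel (finsum B) (finsum B')
      (@bij_sum A A' (fun a => B a) (fun a' => B' a') s t) (subst h);
  subst_unitl : forall (A : finType) (f : opn A)
    (h : forall u : unit, out f = inp (unit_op (out f)) u),
    @subst unit (fun _ => A) (unit_op (out f)) (fun _ => f) h =
    @relabel A (finsum (fun _ : unit => A)) (bij_sum_unitl A) f;
  subst_unitr : forall (A : finType) (f : opn A)
    (h : forall a : A, out (unit_op (inp f a)) = inp f a),
    @subst A (fun _ => unit) f (fun a => unit_op (inp f a)) h =
    @relabel A (finsum (fun _ : A => unit)) (bij_sum_unitr A) f;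
  substA : forall (A : finType) (B : A -> finType)
    (C : forall a, B a -> finType)
    (f : opn A) (g : forall a, opn (B a)) (k : forall a (b : B a), opn (C a b))
    (hfg : forall a, out (g a) = inp f a)
    (hgk : forall a (b : B a), out (k a b) = inp (g a) b)
    (hf_gk : forall a, out (subst (hgk a)) = inp f a)
    (hfg_k : forall s : finsum B,
       out (k (projT1 s) (projT2 s)) = inp (subst hfg) s),
    @subst A (fun a => finsum (C a)) f (fun a => subst (hgk a)) hf_gk =
    @relabel (finsum (fun s : finsum B => C (projT1 s) (projT2 s)))
      (finsum (fun a => finsum (C a)))
      (@bij_sumA A (fun a => B a) (fun a b => C a b))
      (@subst (finsum B) (fun s => C (projT1 s) (projT2 s)) (subst hfg)
         (fun s => k (projT1 s) (projT2 s)) hfg_k) }.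

Arguments opn : clear implicits.
Arguments inp {o A} : rename.
Arguments out {o A} : rename.
Arguments relabel {o A B} : rename.
Arguments unit_op : clear implicits.
Arguments subst {o A B} f g h : rename.

(** The terminal one-colour operad, with a single operation for each finite set
    of slots. *)
Definition Com : operad.
Proof.
refine (@Operad unit (fun _ => unit) (fun _ _ _ => tt) (fun _ _ => tt)
  (fun _ _ _ _ => tt) _ _ _ _ (fun _ => tt) _ _ (fun _ _ _ _ _ => tt)
  _ _ _ _ _ _) => //; try by case.
all: by move=> ? [].
Defined.

(** An object of the strict slice of groupoids over the set [I]; the functor to
    the discrete groupoid [I] is the locally constant function [col]. *)
Record over (I : Type) := Over {
  ov :> groupoid;
  col : ov -> I;
  col_hom : forall x y : ov, hom x y -> col x = col y }.

Arguments col {I o} : rename.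

Record over_map (I : Type) (X Y : over I) := OverMap {
  om_fun :> functor X Y;
  om_col : forall x, col (om_fun x) = col x }.

Definition over1 (X : groupoid) : over unit :=
  @Over unit X (fun _ => tt) (fun _ _ _ => erefl).

Definition over1_map (X Y : groupoid) (F : functor X Y) :
  over_map (over1 X) (over1 Y) :=
  @OverMap unit (over1 X) (over1 Y) F (fun _ => erefl).

Definition terminal_over (I : Type) : over I :=
  @Over I (discG I) id (fun _ _ e => e).

Section PolynomialFunctor.
Variables (R : operad) (X : over (colour R)).

(** The polynomial [I <- E -> B -> I] of the operad: [B] is the groupoid of
    pairs [(A, f)] with [f : opn R A], whose morphisms are the bijections
    relabelling [f] into [f'], the discrete groupoid [A] is the fibre of [E]
    over [(A, f)], and the maps to [I] are [inp] and [out].  In the groupoid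
    below, [(A, f)] comes with a section over this fibre of the pullback of
    [X] along [inp]; the resulting functor of [X] is pullback along [inp],
    followed by the right adjoint of pullback along [E -> B], followed by
    postcomposition with [out]. *)
Record poly_ob := PolyOb {
  po_set : finType;
  po_op : opn R po_set;
  po_fam : po_set -> X;
  po_col : forall a, col (po_fam a) = inp po_op a }.

Arguments po_fam : clear implicits.
Arguments po_col : clear implicits.

Record poly_hom (u v : poly_ob) := PolyHom {
  ph_bij : bij (po_set u) (po_set v);
  ph_op : relabel ph_bij (po_op u) = po_op v;
  ph_fam : forall a, hom (po_fam u a) (po_fam v (ph_bij a)) }.

Lemma poly_hom_eq (u v : poly_ob) (f g : poly_hom u v) :
  (forall a, existT (fun b => hom (po_fam u a) (po_fam v b))
               (ph_bij f a) (ph_fam f a) =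
             existT (fun b => hom (po_fam u a) (po_fam v b))
               (ph_bij g a) (ph_fam g a)) -> f = g.
Proof.
case: f g => [s p m] [t q n] /= e.
have st : s = t by apply: bij_eq => a; exact: (congr1 (@projT1 _ _) (e a)).
case: t / st q n e => q n e.
rewrite (Prop_irrelevance q p); congr PolyHom.
apply: functional_extensionality_dep => a.
exact: existT_inj (e a).
Qed.

Definition poly_id (u : poly_ob) : poly_hom u u :=
  @PolyHom u u (bij_id _) (relabel_id _) (fun a => idm (po_fam u a)).

Definition poly_comp (u v w : poly_ob) (g : poly_hom v w) (f : poly_hom u v) :
  poly_hom u w.
Proof.
refine (@PolyHom u w (bij_comp (ph_bij g) (ph_bij f)) _
  (fun a => ph_fam g (ph_bij f a) ** ph_fam f a)).
by rewrite relabel_comp !ph_op.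
Defined.

Definition poly_inv (u v : poly_ob) (f : poly_hom u v) : poly_hom v u.
Proof.
refine (@PolyHom v u (bij_inv (ph_bij f)) _
  (fun b => invm (idto (congr1 (po_fam v) (binvK (ph_bij f) b)) **
                  ph_fam f (binv (ph_bij f) b)))).
rewrite -(ph_op f) -relabel_comp.
have -> : bij_comp (bij_inv (ph_bij f)) (ph_bij f) = bij_id _.
  by apply: bij_eq => a /=; rewrite bfunK.
exact: relabel_id.
Defined.

Definition polyG : groupoid.
Proof.
refine (@Groupoid poly_ob poly_hom poly_id poly_comp poly_inv _ _ _ _).
- by move=> u v f; apply: poly_hom_eq => a /=; rewrite cmp1m.
- by move=> u v f; apply: poly_hom_eq => a /=; rewrite cmpm1.
- by move=> u v w z h g f; apply: poly_hom_eq => a /=; rewrite cmpA.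
- move=> u v f; apply: poly_hom_eq => a /=.
  move: (binvK _ _); rewrite (bfunK (ph_bij f) a) => e.
  by rewrite (Prop_irrelevance e erefl) /idto /= cmp1m cmpVm.
Defined.

Definition poly : over (colour R).
Proof.
refine (@Over (colour R) polyG (fun u => out (po_op u)) _).
by move=> u v f; rewrite -(ph_op f) out_relabel.
Defined.

End PolynomialFunctor.

Arguments po_fam {R X} u a : rename.
Arguments po_col {R X} u a : rename.

Section MonadStructure.
Variables (R : operad).
Implicit Types X Y : over (colour R).

Definition poly_map_ob X Y (F : over_map X Y) (u : poly X) : poly Y :=
  @PolyOb R Y (po_set u) (po_op u) (fun a => F (po_fam u a))
    (fun a => etrans (om_col F (po_fam u a)) (po_col u a)).

Definition poly_map_hom X Y (F : over_map X Y) (u v : poly X) (f : hom u v) :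
  hom (poly_map_ob F u) (poly_map_ob F v) :=
  @PolyHom R Y (poly_map_ob F u) (poly_map_ob F v) (ph_bij f) (ph_op f)
    (fun a => fmap F (ph_fam f a)).

Definition poly_map X Y (F : over_map X Y) : over_map (poly X) (poly Y).
Proof.
refine (@OverMap _ (poly X) (poly Y)
  (@Functor (poly X) (poly Y) (poly_map_ob F) (poly_map_hom F) _ _)
  (fun _ => erefl)).
- by move=> u; apply: poly_hom_eq => a /=; rewrite fmap1.
- by move=> u v w g f; apply: poly_hom_eq => a /=; rewrite fmapM.
Defined.

(** The unit of the monad, given by the unit operations. *)
Definition poly_unit_ob X (x : X) : poly X.
Proof.
refine (@PolyOb R X unit (unit_op R (col x)) (fun _ => x) _).
by case; rewrite inp_unit.
Defined.

Definition poly_unit_hom X (x y : X) (f : hom x y) :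
  hom (poly_unit_ob x) (poly_unit_ob y).
Proof.
refine (@PolyHom R X (poly_unit_ob x) (poly_unit_ob y) (bij_id unit) _
  (fun _ => f)).
by rewrite relabel_id /= (col_hom f).
Defined.

Definition poly_unit_fun X : functor X (poly X).
Proof.
refine (@Functor X (poly X) (@poly_unit_ob X) (@poly_unit_hom X) _ _).
- by move=> x; apply: poly_hom_eq.
- by move=> x y z g f; apply: poly_hom_eq.
Defined.

Definition poly_unit X : over_map X (poly X) :=
  @OverMap _ X (poly X) (poly_unit_fun X) (fun x => out_unit (col x)).

(** The multiplication of the monad, given by operad substitution. *)
Definition poly_mult_ob X (u : poly (poly X)) : poly X.
Proof.
refine (@PolyOb R X (finsum (fun a => po_set (po_fam u a)))
  (subst (po_op u) (fun a => po_op (po_fam u a)) (po_col u))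
  (fun s => po_fam (po_fam u (projT1 s)) (projT2 s)) _).
by case=> a b; rewrite inp_subst po_col.
Defined.

Definition poly_mult_hom X (u v : poly (poly X)) (f : hom u v) :
  hom (poly_mult_ob u) (poly_mult_ob v).
Proof.
refine (@PolyHom R X (poly_mult_ob u) (poly_mult_ob v)
  (@bij_sum (po_set u) (po_set v) (fun a => po_set (po_fam u a))
     (fun b => po_set (po_fam v b)) (ph_bij f) (fun a => ph_bij (ph_fam f a)))
  _ (fun s => ph_fam (ph_fam f (projT1 s)) (projT2 s))).
case: v f => [B op fam c] [/= s p m].
case: op / p c m => c m.
by symmetry; apply: subst_relabel => a; exact: (ph_op (m a)).
Defined.

Definition poly_mult_fun X : functor (poly (poly X)) (poly X).
Proof.
refine (@Functor (poly (poly X)) (poly X)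
  (@poly_mult_ob X) (@poly_mult_hom X) _ _).
- by move=> u; apply: poly_hom_eq; case.
- by move=> u v w g f; apply: poly_hom_eq; case.
Defined.

Definition poly_mult X : over_map (poly (poly X)) (poly X) :=
  @OverMap _ (poly (poly X)) (poly X) (poly_mult_fun X)
    (fun u => out_subst (po_col u)).

End MonadStructure.

(** The symmetric monoidal category monad: the objects of [Sym X] are the finite
    families of objects of [X], [sym_unit] is the inclusion of the singleton
    families, and [sym_mult] is concatenation. *)
Definition Sym (X : groupoid) : groupoid := @poly Com (over1 X).

Definition Sym_map (X Y : groupoid) (F : functor X Y) :
  functor (Sym X) (Sym Y) := @poly_map Com _ _ (over1_map F).

Definition sym_unit (X : groupoid) : functor X (Sym X) :=
  @poly_unit Com (over1 X).

Definition over1_ov (Y : over unit) : over_map (over1 Y) Y.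
Proof.
refine (@OverMap unit (over1 Y) Y (idF Y) _).
by move=> y; case: (col _).
Defined.

Definition sym_mult (X : groupoid) : functor (Sym (Sym X)) (Sym X) :=
  compF (@poly_mult Com (over1 X))
        (@poly_map Com _ _ (over1_ov (@poly Com (over1 X)))).

(** The transformation from the underlying groupoid of [poly X] to [Sym] of
    the underlying groupoid of [X], forgetting the operation. *)
Definition poly_sym_ob (R : operad) (X : over (colour R)) (u : poly X) :
  Sym X := @PolyOb Com (over1 X) (po_set u) tt (po_fam u) (fun _ => erefl).

Definition poly_sym (R : operad) (X : over (colour R)) :
  functor (poly X) (Sym X).
Proof.
refine (@Functor (poly X) (Sym X) (@poly_sym_ob R X)
  (fun u v f => @PolyHom Com (over1 X) (poly_sym_ob u) (poly_sym_ob v)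
     (ph_bij f) erefl (ph_fam f)) _ _).
- by move=> u; apply: poly_hom_eq.
- by move=> u v w g f; apply: poly_hom_eq.
Defined.

Section BarConstruction.
Variable R : operad.

Definition Alg : over (colour R) := terminal_over (colour R).

Definition alg_fun : functor (poly Alg) Alg :=
  @Functor (poly Alg) Alg (fun u => col u) (fun _ _ f => col_hom f)
    (fun u => @Prop_irrelevance (col u = col u) _ _)
    (fun u _ w _ _ => @Prop_irrelevance (col u = col w) _ _).

Definition alg : over_map (poly Alg) Alg :=
  @OverMap _ (poly Alg) Alg alg_fun (fun _ => erefl).

Fixpoint RnA (n : nat) : over (colour R) :=
  if n is m.+1 then poly (RnA m) else Alg.

(** The inner face map [d_k] from [RnA n.+1] to [RnA n], for [k <= n]. *)
Fixpoint face_R (n k : nat) : over_map (RnA n.+1) (RnA n) :=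
  match n return over_map (RnA n.+1) (RnA n) with
  | 0 => alg
  | m.+1 => if k <= m then poly_map (face_R m k) else @poly_mult R (RnA m)
  end.

(** The degeneracy map [s_k] from [RnA n] to [RnA n.+1], for [k <= n]. *)
Fixpoint degen_R (n k : nat) : over_map (RnA n) (RnA n.+1) :=
  match n return over_map (RnA n) (RnA n.+1) with
  | 0 => @poly_unit R Alg
  | m.+1 => if k <= m then poly_map (degen_R m k) else @poly_unit R (RnA m.+1)
  end.

Definition C (n : nat) : groupoid := RnA n.

Definition D (n : nat) : groupoid := Sym (C n).

(** The face map [d_k] from [D n.+1] to [D n], for [k <= n.+1]. *)
Definition face (n k : nat) : functor (D n.+1) (D n) :=
  if k <= n then Sym_map (face_R n k)
  else compF (sym_mult (C n)) (Sym_map (poly_sym (RnA n))).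

Definition degen (n k : nat) : functor (D n) (D n.+1) :=
  Sym_map (degen_R n k).

(** Homotopy pullback along [d_1], then postcomposition with [(d_2, d_0)]. *)
Definition Delta (X : slice (D 1)) : slice (prodG (D 1) (D 1)) :=
  Slice (compF (pairF (face 1 2) (face 1 0)) (hpull_snd (leg X) (face 1 1))).

Definition Green : slice (D 1) := Slice (sym_unit (C 1)).

(** [w |-> G_w], the fibres of [C 1 -> D 1 -> D 0]. *)
Definition Green_lower : family (D 0) (D 1) :=
  @fibre_family (D 0) (D 1) Green (compF (face 0 1) (leg Green)).

(** [w |-> G^w], the fibres of [d_0 : D 1 -> D 0]. *)
Definition Green_upper : family (D 0) (D 1) :=
  @fibre_family (D 0) (D 1) (Slice (idF (D 1))) (face 0 0).

End BarConstruction.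

(* Main.v *)
(* Both sides are the groupoid [C 2] of two-level trees [(f; g_a)].  On the left,
   [d_1 : D 2 -> D 1] preserves the indexing set of a family, so that the
   homotopy pullback of [Green] along [d_1] consists of the singleton families
   in [D 2].  On the right, the homotopy sum of the products of fibres of two
   maps to [D 0] is the homotopy pullback of these maps; its objects are an
   operation [f], a family of operations [g_i], and a colour-preserving
   bijection between the inputs of [f] and the outputs of the [g_i]. *)
#[warnings="-notation-overridden"]
From mathcomp Require Import all_boot.
From mathcomp Require Import boolp.
Require Import Defs.

Set Implicit Arguments.
Unset Strict Implicit.
Unset Printing Implicit Defensive.

Local Open Scope grpd_scope.

(** * Cancellation and squares in a groupoid *)

Section Groupoids.
Variable X : groupoid.
Implicit Types x y z : X.

Lemma cmpKm x y z (g : hom y z) (f : hom x y) : invm g ** (g ** f) = f.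
Proof. by rewrite cmpA cmpVm cmp1m. Qed.

Lemma cmpVKm x y z (g : hom z y) (f : hom x y) : g ** (invm g ** f) = f.
Proof. by rewrite cmpA cmpmV cmp1m. Qed.

Lemma cmpIm x y z (f : hom x y) (g g' : hom y z) : g ** f = g' ** f -> g = g'.
Proof. by move=> e; rewrite -[g]cmpm1 -(cmpmV f) cmpA e -cmpA cmpmV cmpm1. Qed.

(** Here [i], [j] and [i'], [j'] are the structure isomorphisms of points of two homotopy fibres
    over [b] and [b'], and [m], [n] lie over the same [g]. Eliminating [g] leaves the square of a
    morphism of the homotopy pullback. *)
Lemma fibre_sq (x x' y y' b b' : X) (i : hom x b) (i' : hom x' b')
    (j : hom y b) (j' : hom y' b') (m : hom x x') (n : hom y y') (g : hom b b') :
  i' ** m = g ** i -> j' ** n = g ** j ->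
  n ** (invm j ** i) = (invm j' ** i') ** m.
Proof.
move=> em en; apply: (@cmpmI _ _ _ _ j').
by rewrite -[invm j' ** _ ** m]cmpA cmpVKm em cmpA en -cmpA cmpVKm.
Qed.

Lemma fibre_sq_inv (x x' y y' b b' : X) (i : hom x b) (i' : hom x' b')
    (j : hom y b) (j' : hom y' b') (m : hom x x') (n : hom y y') :
  n ** (invm j ** i) = (invm j' ** i') ** m ->
  i' ** m = (j' ** (n ** invm j)) ** i.
Proof. by rewrite -!cmpA => ->; rewrite cmpVKm. Qed.

End Groupoids.

(** * Equivalences in the weak slice *)

Definition full (X Y : groupoid) (F : functor X Y) : Prop :=
  forall x y (g : hom (F x) (F y)), exists f, fmap F f = g.

Definition faithful (X Y : groupoid) (F : functor X Y) : Prop :=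
  forall x y (f f' : hom x y), fmap F f = fmap F f' -> f = f'.

Definition eso (X Y : groupoid) (F : functor X Y) : Prop :=
  forall y, exists x, inhabited (hom (F x) y).

Lemma slice_equiv_sym (K : groupoid) (X Y : slice K) :
  slice_equiv X Y -> slice_equiv Y X.
Proof. by move=> [f [g [gf fg]]]; exists g, f. Qed.

(** The 2-cell is [a] after [a'] whiskered by [g] and [f]. It lies over [K] by naturality of the
    triangle of [g] at [a']. *)
Lemma comp1_retract (K : groupoid) (X Y Z : slice K) (f : slice1 X Y)
    (g : slice1 Y X) (f' : slice1 Y Z) (g' : slice1 Z Y) :
  slice2 (comp1 g f) (id1 X) -> slice2 (comp1 g' f') (id1 Y) ->
  slice2 (comp1 (comp1 g g') (comp1 f' f)) (id1 X).
Proof.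
move=> a a'.
have nat x y (h : hom x y) :
  h ** (a x ** fmap g (a' (f x))) =
  (a y ** fmap g (a' (f y))) ** fmap g (fmap g' (fmap f' (fmap f h))).
  have /= e := naturality a h; have /= e' := naturality a' (fmap f h).
  by rewrite cmpA e -!cmpA -!fmapM e'.
refine (@Slice2 _ _ _ (comp1 (comp1 g g') (comp1 f' f)) (id1 X)
  (@NatIso _ _ (comp1 (comp1 g g') (comp1 f' f)) (idF _)
    (fun x => a x ** fmap g (a' (f x))) nat) _) => x /=.
have /= <- := s2_tri a x; have /= := s2_tri a' (f x).
have /= := naturality (s1_tri g) (a' (f x)).
rewrite fmapM -!cmpA => e e'; congr (_ ** _).
rewrite 2!cmpA e -!cmpA; congr (_ ** _).
by rewrite 2!cmpA -[_ ** _ ** s1_tri f' _]cmpA e' cmp1m.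
Qed.

Lemma slice_equiv_trans (K : groupoid) (X Y Z : slice K) :
  slice_equiv X Y -> slice_equiv Y Z -> slice_equiv X Z.
Proof.
move=> [f [g [[gf] [fg]]]] [f' [g' [[gf'] [fg']]]].
exists (comp1 f' f), (comp1 g g'); split; constructor; exact: comp1_retract.
Qed.

Section FullyFaithfulEso.
Variables (K : groupoid) (X Y : slice K) (F : slice1 X Y).
Hypotheses (fullF : full F) (faithfulF : faithful F) (esoF : eso F).

Definition full_lift (x y : dom X) (g : hom (F x) (F y)) : hom x y :=
  projT1 (cid (fullF g)).

Lemma full_liftK (x y : dom X) (g : hom (F x) (F y)) : fmap F (full_lift g) = g.
Proof. by rewrite /full_lift; case: cid. Qed.

Definition preim_ob (y : dom Y) : dom X := projT1 (cid (esoF y)).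

Definition preim_iso (y : dom Y) : hom (F (preim_ob y)) y :=
  inhabited_witness (projT2 (cid (esoF y))).

Definition pinv_fun : functor (dom Y) (dom X).
Proof.
refine (@Functor (dom Y) (dom X) preim_ob
  (fun x y h => full_lift (invm (preim_iso y) ** (h ** preim_iso x))) _ _).
- by move=> x; apply: faithfulF; rewrite full_liftK cmp1m cmpVm fmap1.
- move=> x y z g f; apply: faithfulF.
  by rewrite fmapM !full_liftK -!cmpA cmpVKm.
Defined.

(** The triangle is forced by requiring that [preim_iso] be a 2-cell over [K]. *)
Definition pinv : slice1 Y X.
Proof.
refine (@Slice1 K Y X pinv_fun (@NatIso _ _ (leg Y) (compF (leg X) pinv_fun)
  (fun y => invm (s1_tri F (preim_ob y)) **
            fmap (leg Y) (invm (preim_iso y))) _)).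
move=> x y h /=; apply: (@cmpmI _ _ _ _ (s1_tri F (preim_ob y))).
have /= e := naturality (s1_tri F)
  (full_lift (invm (preim_iso y) ** (h ** preim_iso x))).
by rewrite cmpA -e full_liftK -!cmpA !cmpVKm -!fmapM -!cmpA cmpmV cmpm1.
Defined.

Lemma slice_equiv_ff_eso : slice_equiv X Y.
Proof.
exists F, pinv; split; constructor.
- have nat x y (h : hom x y) : h ** full_lift (preim_iso (F x)) =
    full_lift (preim_iso (F y)) ** fmap pinv_fun (fmap F h).
    by apply: faithfulF; rewrite !fmapM !full_liftK cmpVKm.
  refine (@Slice2 _ _ _ (comp1 pinv F) (id1 X)
    (@NatIso _ _ (compF pinv_fun F) (idF _)
      (fun x => full_lift (preim_iso (F x))) nat) _) => x /=.
  apply: (@cmpmI _ _ _ _ (s1_tri F x)).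
  have /= e := naturality (s1_tri F) (full_lift (preim_iso (F x))).
  rewrite cmpA -e full_liftK -!cmpA cmpVKm cmpA -fmapM cmpmV fmap1.
  by rewrite cmp1m cmpm1.
- have nat x y (h : hom x y) : h ** preim_iso x =
    preim_iso y ** fmap F (fmap pinv_fun h) by rewrite full_liftK cmpVKm.
  refine (@Slice2 _ _ _ (comp1 F pinv) (id1 Y)
    (@NatIso _ _ (compF F pinv_fun) (idF _) preim_iso nat) _) => y /=.
  by rewrite cmpVKm -fmapM cmpmV fmap1.
Qed.

End FullyFaithfulEso.

(** * Isomorphism classes and their representatives *)

Lemma pi0_eq (B : groupoid) (c d : pi0 B) (b : B) :
  sval c b -> sval d b -> c = d.
Proof.
case: c d => [P [x eP]] [Q [y eQ]] /=; subst P Q => - [f] [g].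
apply: eq_exist => /=.
apply: funext => z; apply: propext; split=> - [h]; constructor.
- exact: (h ** (invm f ** g)).
- exact: (h ** (invm g ** f)).
Qed.

Lemma pi0_repP (B : groupoid) (c : pi0 B) (b : B) :
  sval c b <-> inhabited (hom (pi0_rep c) b).
Proof. by rewrite /pi0_rep; case: cid => x /= ->. Qed.

Lemma pi0_rep_inj (B : groupoid) (c d : pi0 B) :
  hom (pi0_rep c) (pi0_rep d) -> c = d.
Proof.
move=> f; apply: (@pi0_eq _ _ _ (pi0_rep d)); apply/pi0_repP; constructor=> //.
exact: idm.
Qed.

Lemma pi0_rep_iso (B : groupoid) (b : B) :
  exists c : pi0 B, inhabited (hom b (pi0_rep c)).
Proof.
pose c : pi0 B := exist _ (fun x => inhabited (hom b x)) (ex_intro _ b erefl).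
exists c; have /pi0_repP [f] : sval c b by constructor; exact: idm.
by constructor; exact: (invm f).
Qed.

(** * Homotopy sums of products of fibres are homotopy pullbacks *)

Section HomotopyPullbackSlice.
Variables (B K L : groupoid) (X : slice K) (Y : slice L).
Variables (p : functor (dom X) B) (q : functor (dom Y) B).

Definition hpull_fst : functor (hpull p q) (dom X) :=
  @Functor (hpull p q) (dom X) (@hp_l _ _ _ p q) (fun _ _ f => hph_l f)
    (fun _ => erefl) (fun _ _ _ _ _ => erefl).

Definition hpull_slice : slice (prodG K L) :=
  Slice (pairF (compF (leg X) hpull_fst) (compF (leg Y) (hpull_snd p q))).

Let F := family_prod (fibre_family p) (fibre_family q).

Definition fibre_pull_ob (b : B) (u : dom (F b)) : hpull p q :=
  @HpullOb _ _ _ p q (hf_pt u.1) (hf_pt u.2)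
    (invm (hf_iso u.2) ** hf_iso u.1).

Definition fibre_pull_hom (b : B) (u v : dom (F b)) (f : hquot_hom u v) :
  hom (fibre_pull_ob u) (fibre_pull_ob v).
Proof.
refine (@HpullHom _ _ _ p q (fibre_pull_ob u) (fibre_pull_ob v)
  (hfh (hq_hom f).1) (hfh (hq_hom f).2) _).
exact: fibre_sq (hfh_tri (hq_hom f).1) (hfh_tri (hq_hom f).2).
Defined.

Definition fibre_pull (b : B) : functor (hquot F b) (hpull p q).
Proof.
refine (@Functor (hquot F b) (hpull p q)
  (@fibre_pull_ob b) (@fibre_pull_hom b) _ _).
- by move=> u; apply: hpull_hom_eq.
- move=> u v w g f; apply: hpull_hom_eq => /=; by rewrite cmpm1.
Defined.

Lemma fibre_pull_faithful (b : B) : faithful (fibre_pull b).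
Proof.
move=> u v f f' e.
have := congr1 (@hph_l _ _ _ _ _ _ _) e; have := congr1 (@hph_r _ _ _ _ _ _ _) e.
case: f f' {e} => [g [m n]] [g' [m' n']] /= en em.
(* The triangle of the second component reads [hf_iso v.2 ** fmap q n = g ** hf_iso u.2], so [n]
   determines the automorphism. *)
have eg : g = g'.
  apply: (@cmpIm _ _ _ _ (hf_iso u.2)).
  by have /= <- := hfh_tri n; have /= <- := hfh_tri n'; rewrite en.
case: g' / eg m' n' en em => m' n' en em.
congr HquotHom; congr pair.
- exact: (@hfib_hom_eq _ _ p b _ _ m m' em).
- exact: (@hfib_hom_eq _ _ q b _ _ n n' en).
Qed.

Definition hsum_pull_fun : functor (dom (hsum F)) (hpull p q) :=
  copairF (fun c : pi0 B => fibre_pull (pi0_rep c)).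

Definition hsum_pull : slice1 (hsum F) hpull_slice.
Proof.
refine (@Slice1 _ (hsum F) hpull_slice hsum_pull_fun
  (@NatIso _ _ (leg (hsum F)) (compF (leg hpull_slice) hsum_pull_fun)
    (fun u => idm (leg (hsum F) u)) _)).
case=> [c u] [d v] [/= e f]; case: d / e v f => v [g [m n]] /=.
by rewrite !cmp1m !cmpm1.
Defined.

Lemma hsum_fibre_prod : slice_equiv (hsum F) hpull_slice.
Proof.
apply: (@slice_equiv_ff_eso _ _ _ hsum_pull).
- case=> [c u] [d v] /= [m n /= sq].
  (* Conjugating [fmap q n] by the structure isomorphisms gives a morphism between the chosen
     representatives, so the two classes coincide. *)
  have e : c = d.
    apply: pi0_rep_inj.
    exact: (hf_iso v.2 ** (fmap q n ** invm (hf_iso u.2))).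
  case: d / e v m n sq => v m n sq.
  (* The only automorphism compatible with [n]; the pullback square makes it compatible with [m] as
     well. *)
  set g := hf_iso v.2 ** (fmap q n ** invm (hf_iso u.2)).
  have em : hf_iso v.1 ** fmap p m = g ** hf_iso u.1 by exact: fibre_sq_inv.
  have en : hf_iso v.2 ** fmap q n = g ** hf_iso u.2.
    by rewrite -!cmpA cmpVm cmpm1.
  exists (coprod_in (X := fun c : pi0 B => hquot F (pi0_rep c))
    (@HquotHom _ _ F _ u v g
      (@HfibHom _ _ p _ (fibre_act_fun p g u.1) v.1 m em,
       @HfibHom _ _ q _ (fibre_act_fun q g u.2) v.2 n en))).
  exact: hpull_hom_eq.
- case=> [c u] [d v] [/= e f] [/= e' f']; case: d / e v f e' f' => v f e' f'.
  rewrite (Prop_irrelevance e' erefl) {e'} in f' *.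
  by move=> /fibre_pull_faithful e; congr existT.
- move=> [x y h]; have [c [i]] := pi0_rep_iso (q y).
  (* Transporting both points along [i] puts them over the representative, and the comparison
     [invm i ** (i ** h)] cancels to [h]. *)
  exists (existT (fun c : pi0 B => hquot F (pi0_rep c)) c
    (@HfibOb _ _ p _ x (i ** h), @HfibOb _ _ q _ y i)); constructor.
  refine (@HpullHom _ _ _ p q (@HpullOb _ _ _ p q x y (invm i ** (i ** h)))
    (HpullOb h) (idm x) (idm y) _).
  by rewrite /= cmpKm !fmap1 cmp1m cmpm1.
Qed.

End HomotopyPullbackSlice.

(** * Thin groupoids and singleton families *)

Definition thin (X : groupoid) : Prop :=
  forall (x y : X) (f g : hom x y), f = g.

Lemma discG_thin (I : Type) : thin (discG I).
Proof. move=> x y f g; exact: (@Prop_irrelevance (x = y)). Qed.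

(** Serves for squares over [D R 0], whose families consist of colours: only the bijections have to
    be compared. *)
Lemma poly_thin_hom_eq (R : operad) (X : over (colour R)) (x y : poly X)
    (f g : hom x y) : thin X -> ph_bij f =1 ph_bij g -> f = g.
Proof.
move=> thinX e; apply: poly_hom_eq => a.
case: f g e => [s p m] [t q n] /= /bij_eq e; case: t / e q n => q n.
congr existT; exact: thinX.
Qed.

Lemma sym_unit_faithful (X : groupoid) : faithful (sym_unit X).
Proof.
move=> x y f f' e.
exact: (congr1 (fun g : hom (sym_unit X x) (sym_unit X y) =>
  ph_fam g tt : hom x y) e).
Qed.

Lemma sym_unit_full (X : groupoid) : full (sym_unit X).
Proof.
move=> x y g; exists (ph_fam g tt); apply: poly_hom_eq => - [] /=.
by case: (ph_bij g tt).
Qed.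

(** The two singleton families differ only in their proofs [po_col]; an isomorphism that is the
    identity on data avoids transports. *)
Definition single_map (X Y : groupoid) (F : functor X Y) (x : X) :
  hom (sym_unit Y (F x)) (Sym_map F (sym_unit X x)) :=
  @PolyHom Com (over1 Y) (sym_unit Y (F x)) (Sym_map F (sym_unit X x))
    (bij_id unit) erefl (fun _ => idm (F x)).

Lemma single_map_nat (X Y : groupoid) (F : functor X Y) (x y : X) (f : hom x y) :
  fmap (Sym_map F) (fmap (sym_unit X) f) ** single_map F x =
  single_map F y ** fmap (sym_unit Y) (fmap F f).
Proof. by apply: poly_hom_eq => a /=; rewrite cmp1m cmpm1. Qed.

Definition single_map_iso (X Y : groupoid) (F : functor X Y) :
  nat_iso (compF (sym_unit Y) F) (compF (Sym_map F) (sym_unit X)) :=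
  @NatIso _ _ (compF (sym_unit Y) F) (compF (Sym_map F) (sym_unit X))
    (single_map F) (single_map_nat F).

(** Concatenating a one-member family of families returns that member, reindexed from [A] to
    [{_ : unit & A}]. This computes the top face on singletons. *)
Definition flatten_single (X Y : groupoid) (G : functor X (Sym Y)) :
  nat_iso G (compF (compF (sym_mult Y) (Sym_map G)) (sym_unit X)).
Proof.
refine (@NatIso _ _ G (compF (compF (sym_mult Y) (Sym_map G)) (sym_unit X))
  (fun x => @PolyHom Com (over1 Y) (G x)
     (sym_mult Y (Sym_map G (sym_unit X x)))
     (bij_sum_unitl (po_set (G x))) erefl (fun a => idm (po_fam (G x) a))) _).
by move=> x y f; apply: poly_hom_eq => a /=; rewrite cmp1m cmpm1.
Defined.

Definition pair_iso (X Y Z W : groupoid) (F : functor X Y) (G : functor X Z)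
    (S : functor X W) (P : functor W Y) (Q : functor W Z)
    (s : nat_iso F (compF P S)) (t : nat_iso G (compF Q S)) :
  nat_iso (pairF F G) (compF (pairF P Q) S) :=
  @NatIso _ _ (pairF F G) (compF (pairF P Q) S) (fun x => (s x, t x))
    (fun x y f => f_equal2 pair (naturality s f) (naturality t f)).

(** * The naturality square of the unit of [Sym] is homotopy cartesian *)

Section SingletonPullback.
Variables (X Y : groupoid) (F : functor X Y).

Definition single_pull_ob (x : X) : hpull (sym_unit Y) (Sym_map F) :=
  @HpullOb _ _ _ (sym_unit Y) (Sym_map F) (F x) (sym_unit X x) (single_map F x).

Definition single_pull_hom (x y : X) (f : hom x y) :
  hom (single_pull_ob x) (single_pull_ob y) :=
  @HpullHom _ _ _ (sym_unit Y) (Sym_map F) (single_pull_ob x) (single_pull_ob y)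
    (fmap F f) (fmap (sym_unit X) f) (single_map_nat F f).

Definition single_pull : functor X (hpull (sym_unit Y) (Sym_map F)).
Proof.
refine (@Functor X (hpull (sym_unit Y) (Sym_map F))
  single_pull_ob single_pull_hom _ _).
- by move=> x; apply: hpull_hom_eq; rewrite [LHS]fmap1.
- by move=> x y z g f; apply: hpull_hom_eq; rewrite [LHS]fmapM.
Defined.

Lemma single_pull_faithful : faithful single_pull.
Proof.
move=> x y f f' /(congr1 (@hph_r _ _ _ _ _ _ _)).
exact: sym_unit_faithful.
Qed.

Lemma single_pull_full : full single_pull.
Proof.
move=> x y [l r sq]; have [f fr] := sym_unit_full r.
exists f; apply: hpull_hom_eq => //=.
(* The left component is forced by the square, since [single_map F y] is invertible. *)
apply: sym_unit_faithful; apply: (@cmpmI _ _ _ _ (single_map F y)).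
by rewrite -single_map_nat fr.
Qed.

Lemma single_pull_eso : eso single_pull.
Proof.
move=> [y [A op fam c] h].
case: op c h => c h; pose b : bij unit A := ph_bij h.
(* As [b] identifies [A] with [unit], the family is a singleton whose only member sits at [b tt]. *)
exists (fam (b tt)); constructor.
refine (@HpullHom _ _ _ (sym_unit Y) (Sym_map F) (single_pull_ob (fam (b tt)))
  (HpullOb h) (invm (ph_fam h tt))
  (@PolyHom Com (over1 X) (sym_unit X (fam (b tt))) (PolyOb c) b erefl
    (fun a => match a with tt => idm (fam (b tt)) end)) _).
by apply: poly_hom_eq => - [] /=; rewrite cmpmV fmap1 cmp1m.
Qed.

Lemma single_pull_equiv (K : groupoid) (P : functor (Sym X) K)
    (Q : functor X K) :
  nat_iso Q (compF P (sym_unit X)) ->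
  slice_equiv (Slice Q) (Slice (compF P (hpull_snd (sym_unit Y) (Sym_map F)))).
Proof.
move=> t.
pose S := Slice (compF P (hpull_snd (sym_unit Y) (Sym_map F))).
pose f : slice1 (Slice Q) S := @Slice1 K (Slice Q) S single_pull
  (@NatIso _ _ Q (compF (leg S) single_pull) t (@naturality _ _ _ _ t)).
apply: (@slice_equiv_ff_eso _ _ _ f).
- exact: single_pull_full.
- exact: single_pull_faithful.
- exact: single_pull_eso.
Qed.

End SingletonPullback.

(** * Two-level trees and the two homotopy pullbacks *)

Section BarComparison.
Variable R : operad.

(** The bottom face on [C R 2]: the upper operations are replaced by their output colours, leaving
    the root operation. *)
Definition prune : functor (C R 2) (C R 1) := poly_map (alg R).

Let right_pull := @hpull_slice _ _ _ (Slice (idF (D R 1))) (Green R)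
  (face R 0 0) (compF (face R 0 1) (leg (Green R))).

(** The output colours of the upper operations match the input colours of the root. The bijection
    appears because the right-hand side concatenates a singleton family. *)
Definition graft_iso (u : C R 2) :
  hom (face R 0 0 (poly_sym (RnA R 1) u))
      (face R 0 1 (sym_unit (C R 1) (prune u))) :=
  @PolyHom Com (over1 (C R 0)) (face R 0 0 (poly_sym (RnA R 1) u))
    (face R 0 1 (sym_unit (C R 1) (prune u)))
    (bij_sum_unitl (po_set u)) erefl (fun _ => erefl).

Let pull_ob := @HpullOb _ _ _ (face R 0 0) (compF (face R 0 1) (leg (Green R))).
Let pull_hom := @HpullHom _ _ _ (face R 0 0) (compF (face R 0 1) (leg (Green R))).

Definition tree_pull_ob (u : C R 2) : dom right_pull :=
  pull_ob (graft_iso u).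

Definition tree_pull_fun : functor (C R 2) (dom right_pull).
Proof.
refine (@Functor (C R 2) (dom right_pull) tree_pull_ob
  (fun u v f => @pull_hom (tree_pull_ob u) (tree_pull_ob v)
     (fmap (poly_sym (RnA R 1)) f) (fmap prune f) _) _ _).
- move=> u; apply: hpull_hom_eq.
  + exact: (fmap1 (poly_sym (RnA R 1)) u).
  + exact: (fmap1 prune u).
- move=> u v w g f; apply: hpull_hom_eq.
  + exact: (fmapM (poly_sym (RnA R 1)) g f).
  + exact: (fmapM prune g f).
Unshelve.
by apply: poly_thin_hom_eq => [|a]; first exact: discG_thin.
Defined.

Lemma tree_pull_faithful : faithful tree_pull_fun.
Proof.
move=> u v f f' /(congr1 (@hph_l _ _ _ _ _ _ _)) /= e.
apply: poly_hom_eq => a.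
exact: (congr1 (fun g : hom (poly_sym (RnA R 1) u) (poly_sym (RnA R 1) v) =>
  existT (fun b => hom (po_fam u a) (po_fam v b)) (ph_bij g a) (ph_fam g a)) e).
Qed.

Lemma tree_pull_full : full tree_pull_fun.
Proof.
move=> u v [l r sq].
(* The square over [D R 0] compares the bijections. Then [r] supplies the relabelling equation for
   the root, which [l] forgets, and [l] supplies the morphisms of upper operations. *)
have lr : ph_bij l = ph_bij r :> bij (po_set u) (po_set v).
  apply: bij_eq => a.
  have e := congr1 (@bfun _ _) (congr1 (@ph_bij _ _ _ _) sq).
  exact: (congr1 (fun s : po_set u -> finsum (fun _ : unit => po_set v) =>
    projT2 (s a)) (esym e)).
have op : relabel (ph_bij l : bij (po_set u) (po_set v)) (po_op u) = po_op v.
  by rewrite lr (ph_op r).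
exists (@PolyHom R (RnA R 1) u v (ph_bij l) op (ph_fam l)).
apply: hpull_hom_eq => /=.
- by apply: poly_hom_eq.
- by apply: poly_thin_hom_eq => [|a]; [exact: discG_thin | rewrite -lr].
Qed.

Lemma tree_pull_eso : eso tree_pull_fun.
Proof.
move=> [y x h].
pose b : bij (po_set y) (finsum (fun _ : unit => po_set x)) := ph_bij h.
pose famh : forall a, out (po_op (po_fam y a)) = po_fam x (projT2 (b a)) :=
  ph_fam h.
(* [s] sends each slot of the root [x] to the member of [y] that [h] matches with it. Reindexing [y]
   along [s] grafts these operations onto [x]. *)
pose s : bij (po_set x) (po_set y) := bij_comp (bij_inv b) (bij_sum_unitl _).
have fam a : out (po_op (po_fam y (s a))) = po_fam x a.
  by rewrite famh /s /= binvK.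
pose u : C R 2 := @PolyOb R (RnA R 1) (po_set x) (po_op x)
  (fun a => po_fam y (s a)) (fun a => etrans (fam a) (po_col x a)).
have op_y : tt = po_op y by case: (po_op y).
exists u; constructor.
refine (@pull_hom (tree_pull_ob u) (pull_ob h)
  (@PolyHom Com (over1 (C R 1)) (poly_sym (RnA R 1) u) y s op_y
     (fun a => idm (po_fam y (s a))))
  (@PolyHom R (Alg R) (prune u) x (bij_id _) (relabel_id _) fam) _).
apply: poly_thin_hom_eq => [|a]; first exact: discG_thin.
exact: (esym (binvK b (existT _ tt a))).
Qed.

(** The first leg gives the family of upper operations, the second the singleton on the root, in the
    order of [(d_2, d_0)]. *)
Definition tree : slice (prodG (D R 1) (D R 1)) :=
  Slice (pairF (poly_sym (RnA R 1)) (compF (sym_unit (C R 1)) prune)).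

Lemma tree_pull_equiv : slice_equiv tree right_pull.
Proof.
have nat (u v : C R 2) (f : hom u v) :
  fmap (leg tree) f ** idm (leg tree u) = idm (leg tree v) ** fmap (leg tree) f.
  by rewrite cmp1m cmpm1.
pose t : slice1 tree right_pull := @Slice1 _ tree right_pull tree_pull_fun
  (@NatIso _ _ (leg tree) (compF (leg right_pull) tree_pull_fun)
    (fun u => idm (leg tree u)) nat).
apply: (@slice_equiv_ff_eso _ _ _ t).
- exact: tree_pull_full.
- exact: tree_pull_faithful.
- exact: tree_pull_eso.
Qed.

Lemma tree_Delta_equiv : slice_equiv tree (Delta (Green R)).
Proof.
(* On a singleton family, [d_2] flattens to the upper operations of its tree and [d_0] prunes it to
   its root. *)
have i : nat_iso (leg tree)
  (compF (pairF (face R 1 2) (face R 1 0)) (sym_unit (C R 2))).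
  pose d2 := @flatten_single (C R 2) (C R 1) (poly_sym (RnA R 1)).
  pose d0 := single_map_iso prune.
  exact: (pair_iso d2 d0).
(* The face [d_1] computes to [Sym_map] of [poly_mult], so the pullback defining [Delta (Green R)]
   is an instance of the cartesian square for the unit. *)
have := @single_pull_equiv (C R 2) (C R 1) (poly_mult (Alg R)) _
  (pairF (face R 1 2) (face R 1 0)) _ i.
exact.
Qed.

End BarComparison.

Theorem mainTheorem2 (R : operad) :
  slice_equiv (Delta (Green R))
    (hsum (family_prod (Green_upper R) (Green_lower R))).
Proof.
apply: slice_equiv_trans (slice_equiv_sym (hsum_fibre_prod _ _)).
apply: slice_equiv_trans (tree_pull_equiv R).
exact: slice_equiv_sym (tree_Delta_equiv R).
Qed.
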